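(* Let $\Phi(x)$ and $\widetilde\Phi(x)$ be $2\times 2$ complex matrix functions of $x$ (the exact and the computed basis matrices), let $x_0$ be a base point, and write $\Delta\Phi=\widetilde\Phi-\Phi$, so $\widetilde\Phi=\Phi+\Delta\Phi$. Assume that both initial matrices $\Phi(x_0)$ and $\widetilde\Phi(x_0)$ are invertible, and put $$F_C(x)=\Phi(x)\Phi(x_0)^{-1},\qquad \widetilde F_C(x)=\widetilde\Phi(x)\widetilde\Phi(x_0)^{-1}.$$ Then for every $x$ the following exact identity holds: $$\widetilde F_C(x)-F_C(x)=\bigl(\Delta\Phi(x)-F_C(x)\,\Delta\Phi(x_0)\bigr)\,\widetilde\Phi(x_0)^{-1}.$$
   Context: In the intended application $\Phi(x)$ is the matrix whose two columns are $(y,y_x)^T$ for two solutions $y$ (given by contour integrals) of a scalar linear equation $y_{xx}=U(x)y$, $F_C$ is the fundamental matrix normalized by $F_C(x_0)=I$, and $\widetilde\Phi$ is a numerical approximation to $\Phi$. *)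

(* Defs.v *)
From mathcomp Require Import all_boot all_order all_algebra.
From mathcomp Require Import reals.
From mathcomp.real_closed Require Import complex.

Set Implicit Arguments.
Unset Strict Implicit.
Unset Printing Implicit Defensive.

Import GRing.Theory.
Local Open Scope ring_scope.
Local Open Scope complex_scope.

(* For R : realType, R[i] is the field of complex numbers.  The independent
   variable ranges over an arbitrary type X, e.g. a real interval or a domain
   of the complex plane. *)

(* [invmx] is the matrix inverse only on invertible matrices, so this has its
   intended meaning under the hypothesis [Phi x0 \in unitmx]; in that case the
   value at x0 is the identity. *)
Definition normalized_fundamental (R : realType) (X : Type)
    (Phi : X -> 'M[R[i]]_2) (x0 x : X) : 'M[R[i]]_2 :=
  Phi x *m invmx (Phi x0).

Definition basis_error (R : realType) (X : Type)
    (Phi Phit : X -> 'M[R[i]]_2) (x : X) : 'M[R[i]]_2 :=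
  Phit x - Phi x.

(* Main.v *)
Require Import Defs.
From mathcomp Require Import all_boot all_order all_algebra.
From mathcomp Require Import reals.
From mathcomp.real_closed Require Import complex.

Local Open Scope ring_scope.
Local Open Scope complex_scope.

(** Normalization gives $F_C(x)\Phi(x_0)=\Phi(x)$, so $\Phi(x)$ cancels from the bracket, leaving
    $\widetilde\Phi(x)-F_C(x)\widetilde\Phi(x_0)$; multiplying by $\widetilde\Phi(x_0)^{-1}$ on the
    right gives $\widetilde F_C(x)-F_C(x)$. *)

Theorem mainTheorem1 (R : realType) (X : Type)
    (Phi Phit : X -> 'M[R[i]]_2) (x0 : X)
    (hPhi : Phi x0 \in unitmx) (hPhit : Phit x0 \in unitmx) :
  forall x : X,
    normalized_fundamental Phit x0 x - normalized_fundamental Phi x0 x =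
    (basis_error Phi Phit x
       - normalized_fundamental Phi x0 x *m basis_error Phi Phit x0)
      *m invmx (Phit x0).
Proof.
(* [mulmxKV] uses [hPhi] to turn $F_C(x)\Phi(x_0)$ into $\Phi(x)$; the other product with $F_C(x)$
   is left for [mulmxK] and [hPhit]. *)
move=> x; rewrite /basis_error mulmxBr {3}/normalized_fundamental mulmxKV //.
by rewrite GRing.opprB GRing.addrA GRing.subrK mulmxBl mulmxK.
Qed.
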